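(* Let $I=[0,1]$ with Lebesgue measure $m$ and let $S$ be the one-sided Bernoulli shift on $(I^{\infty},m^{\infty})$. Let $\mathfrak{M}=\{\{t_n\}_{n\ge1}: t_n\in\{1,\dots,n\}\}$ with the measure $\mu=\prod_n\mu_n$, $\mu_n$ uniform on $\{1,\dots,n\}$. For $t\in\mathfrak{M}$ define marked positions: position $1$ is marked, and position $n+1$ is marked iff $t_{n+1}\le d_n(t)$, where $d_n(t)$ is the number of marked positions among $1,\dots,n$. Define $\Lambda:\mathfrak{M}\to\mathfrak{M}$ by $\Lambda(t)_n=t_{n+1}$ if position $n+1$ is marked and $\Lambda(t)_n=t_{n+1}-1$ otherwise. Then $(I^{\infty},m^{\infty},S)$ is metrically isomorphic to $(\mathfrak{M},\mu,\Lambda)$; an isomorphism is given by $J(\{x_n\})_n=\#\{i\le n: x_i\le x_n\}$ (defined on sequences with pairwise distinct coordinates), which satisfies $J\circ S=\Lambda\circ J$ almost everywhere. Moreover the cylinder partitions $\eta_n$ of $I^{\infty}$ over the open Weyl simplices of $I^n$ form an exhausting increasing sequence of finite partitions (their product is mod $0$ the partition into singletons).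
   Context: The open Weyl simplices of $I^n$ are the sets of points of $(0,1)^n$ with pairwise distinct coordinates and a fixed collection of pairwise inequalities between their coordinates. *)

(* Defs.v *)
From HB Require Import structures.
From mathcomp Require Import all_boot all_order all_algebra.
From mathcomp Require Import finmap.
From mathcomp Require Import all_classical all_reals all_analysis.

Set Implicit Arguments.
Unset Strict Implicit.
Unset Printing Implicit Defensive.

Import Order.TTheory GRing.Theory Num.Theory.
Import numFieldNormedType.Exports.

Local Open Scope classical_set_scope.
Local Open Scope ring_scope.

(* Infinite sequences are functions on nat; index k stands for position k + 1
   of the 1-based sequences of the mathematical text. *)

Definition countprod (d : measure_display) (T : nat -> measurableType d) : Type :=
  forall k, T k.

Definition countprod_display : measure_display -> measure_display.
Proof. exact. Qed.

Section countprod_measurable.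
Context {d : measure_display} (T : nat -> measurableType d).

HB.instance Definition _ := gen_eqMixin (countprod T).
HB.instance Definition _ := gen_choiceMixin (countprod T).
HB.instance Definition _ := isPointed.Build (countprod T) (fun k => point).

Definition g_sigma_coord : set (set (countprod T)) :=
  <<s \bigcup_k preimage_set_system setT (fun x : countprod T => x k) measurable >>.

Let coord_set0 : g_sigma_coord set0.
Proof. exact: sigma_algebra0. Qed.

Let coord_setC A : g_sigma_coord A -> g_sigma_coord (~` A).
Proof. exact: sigma_algebraC. Qed.

Let coord_bigcup (F : (set (countprod T))^nat) :
  (forall i, g_sigma_coord (F i)) -> g_sigma_coord (\bigcup_i F i).
Proof. exact: sigma_algebra_bigcup. Qed.

HB.instance Definition _ := @isMeasurable.Build (countprod_display d)
  (countprod T) g_sigma_coord coord_set0 coord_setC coord_bigcup.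

End countprod_measurable.

(* The boxes below are a pi-system generating the sigma-algebra of [countprod T],
   so this determines P uniquely: P is the product of the m k. *)
Definition is_product_measure (R : realType) (d : measure_display)
    (T : nat -> measurableType d) (m : forall k, probability (T k) R)
    (P : probability (countprod T) R) : Prop :=
  forall (n : nat) (A : forall k, set (T k)), (forall k, measurable (A k)) ->
    P [set x : countprod T | forall k, (k < n)%N -> A k (x k)] =
    (\prod_(k < n) m k (A k))%E.

Section mod0.
Context {R : realType} {d : measure_display} {X : measurableType d}.
Implicit Types (P : probability X R) (xi zeta : set (set X)).

Definition measure_preserving P (T : X -> X) : Prop :=
  measurable_fun setT T /\ forall A, measurable A -> P (T @^-1` A) = P A.

Definition finite_partition_mod0 P xi : Prop :=
  [/\ finite_set xi,
      forall C, xi C -> measurable C /\ C !=set0,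
      trivIset xi id
    & P (\bigcup_(C in xi) C) = 1%E].

Definition refines xi zeta : Prop :=
  forall C, xi C -> exists2 D, zeta D & C `<=` D.

Definition partition_product (xi : nat -> set (set X)) : set (set X) :=
  [set C | C !=set0 /\
     exists2 F : nat -> set X, forall n, xi n (F n) & C = \bigcap_n F n].

Definition point_partition : set (set X) := [set [set x] | x in setT].

Definition trace_partition xi (A : set X) : set (set X) :=
  [set C `&` A | C in xi] `\ set0.

Definition eq_partition_mod0 P xi zeta : Prop :=
  exists A, [/\ measurable A, P A = 1%E
    & trace_partition xi A = trace_partition zeta A].

End mod0.

Definition is_metric_isomorphism (R : realType) (d d' : measure_display)
    (X : measurableType d) (Y : measurableType d')
    (P : probability X R) (T : X -> X) (Q : probability Y R) (U : Y -> Y)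
    (phi : X -> Y) : Prop :=
  [/\ measure_preserving P T, measure_preserving Q U
    & exists (A : set X) (B : set Y),
      [/\ measurable A /\ P A = 1%E,
          measurable B /\ Q B = 1%E,
          (forall x, A x -> A (T x)) /\ (forall y, B y -> B (U y)),
          set_bij A B phi
        & [/\ forall D, measurable D -> D `<=` B ->
                measurable (A `&` phi @^-1` D) /\ P (A `&` phi @^-1` D) = Q D,
              forall C, measurable C -> C `<=` A -> measurable (phi @` C)
            & forall x, A x -> phi (T x) = U (phi x)]]].

Definition metrically_isomorphic (R : realType) (d d' : measure_display)
    (X : measurableType d) (Y : measurableType d')
    (P : probability X R) (T : X -> X) (Q : probability Y R) (U : Y -> Y) :
    Prop :=
  exists phi : X -> Y, is_metric_isomorphism P T Q U phi.

Definition unitI (R : realType) : Type := set_type [set` `[0 : R, 1]].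

Section unit_interval.
Context {R : realType}.

Let zero_in : (0 : R) \in [set` `[0 : R, 1]].
Proof. by rewrite inE /= in_itv /= lexx ler01. Qed.

HB.instance Definition _ := Choice.on (unitI R).
HB.instance Definition _ := isPointed.Build (unitI R) (exist _ 0 zero_in).

Definition uval (x : unitI R) : measurableTypeR R := \val x.

HB.instance Definition _ :=
  Measurable.copy (unitI R) (g_sigma_algebra_preimageType uval).

Definition lebesgueI (A : set (unitI R)) : \bar R :=
  lebesgue_measure (uval @` A).

Let measurable_uval_image (A : set (unitI R)) :
  measurable A -> measurable (uval @` A).
Proof.
move=> [B mB <-]; rewrite setTI.
have -> : uval @` (uval @^-1` B) = [set` `[0 : R, 1]] `&` B.
  apply/seteqP; split => [_ [x Bx <-]|y [yI By]].
    by split => //; have := set_valP x.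
  by exists (exist _ y (mem_set yI)).
by apply: measurableI => //; exact: measurable_itv.
Qed.

Let lebesgueI0 : lebesgueI set0 = 0%E.
Proof. by rewrite /lebesgueI image_set0 measure0. Qed.

Let lebesgueI_ge0 A : (0 <= lebesgueI A)%E.
Proof. exact: measure_ge0. Qed.

Let lebesgueI_sigma_additive : semi_sigma_additive lebesgueI.
Proof.
move=> F mF tF mUF; rewrite /lebesgueI image_bigcup.
apply: measure_semi_sigma_additive.
- by move=> i; exact: measurable_uval_image.
- apply/trivIsetP => i j _ _ ij.
  apply/seteqP; split => // y [[x Fx <-] [x' Fx' /val_inj xx']].
  move/trivIsetP : tF => /(_ i j I I ij) Fij.
  suff : (F i `&` F j) x by rewrite Fij.
  by split => //; rewrite -xx'.
- by rewrite -image_bigcup; exact: measurable_uval_image.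
Qed.

HB.instance Definition _ := isMeasure.Build _ _ _ lebesgueI
  lebesgueI0 lebesgueI_ge0 lebesgueI_sigma_additive.

Let lebesgueIT : lebesgueI setT = 1%E.
Proof.
rewrite /lebesgueI.
have -> : uval @` setT = [set` `[0 : R, 1]].
  apply/seteqP; split => [_ [x _ <-]|y yI]; first exact: (set_valP x).
  by exists (exist _ y (mem_set yI)).
by rewrite lebesgue_measure_itv /= lte_fin ltr01 oppr0 adde0.
Qed.

HB.instance Definition _ :=
  Measure_isProbability.Build _ _ _ lebesgueI lebesgueIT.

End unit_interval.

Arguments lebesgueI : clear implicits.

Definition Iinf (R : realType) := countprod (fun=> unitI R).

Definition bernoulli_shift (R : realType) (x : Iinf R) : Iinf R := fun k => x k.+1.

Definition distinct_coords (R : realType) : set (Iinf R) :=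
  [set x | injective x].
Arguments distinct_coords : clear implicits.

(* digit k is {1, ..., k + 1}, the range of the term at position k + 1. *)
Definition digit (k : nat) : Type := {t : nat | (0 < t <= k.+1)%N}.

Definition digit_val (k : nat) (t : digit k) : nat := \val t.

Definition digit_display : measure_display.
Proof. exact: default_measure_display. Qed.

Section digit_measurable.
Variable k : nat.

HB.instance Definition _ := Choice.on (digit k).
HB.instance Definition _ :=
  isPointed.Build (digit k) (exist _ 1%N (isT : (0 < 1 <= k.+1)%N)).
HB.instance Definition _ := @isMeasurable.Build digit_display
  (digit k) (@discrete_measurable (digit k))
  (@discrete_measurable0 _) (@discrete_measurableC _) (@discrete_measurableU _).

End digit_measurable.

Section uniform_digit.
Context {R : realType} (k : nat).

Definition uniform_digit : set (digit k) -> \bar R :=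
  mscale (k.+1%:R^-1)%:nng counting.

HB.instance Definition _ := Measure.on uniform_digit.

Let uniform_digitT : uniform_digit setT = 1%E.
Proof.
have cardT : ([set: digit k] #= `I_k.+1)%card.
  pose f (t : digit k) := (digit_val t).-1.
  have f_inj : {in [set: digit k] &, injective f}.
    move=> a b _ _ ab; have /andP[a0 _] := valP a; have /andP[b0 _] := valP b.
    by apply: val_inj; rewrite -(prednK a0) -(prednK b0); congr _.+1.
  rewrite card_eq_sym; have -> : `I_k.+1 = f @` [set: digit k].
    apply/seteqP; split => [i /= ik|_ [a _ <-]].
      by exists (exist _ i.+1 (ik : (0 < i.+1 <= k.+1)%N)).
    by have /andP[a0 ak] := valP a; rewrite /f /= prednK.
  exact: inj_card_eq.
have finT : finite_set [set: digit k] by exists k.+1.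
rewrite /uniform_digit /mscale /= /counting asboolT//.
have -> : #|` fset_set [set: digit k]|%fset = k.+1.
  by apply/card_eq_fsetP; rewrite fset_setK.
by rewrite -EFinM /= mulVf.
Qed.

HB.instance Definition _ :=
  Measure_isProbability.Build _ _ _ uniform_digit uniform_digitT.

End uniform_digit.

Arguments uniform_digit : clear implicits.

Definition triangular := countprod digit.

(* nmarked t n is d_n(t), the number of marked positions among 1, ..., n. *)
Fixpoint nmarked (t : triangular) (n : nat) : nat :=
  if n is k.+1 then
    (nmarked t k + ((k == 0) || (digit_val (t k) <= nmarked t k)))%N
  else 0%N.

(* marked t k: position k + 1 is marked. *)
Definition marked (t : triangular) (k : nat) : bool :=
  (k == 0)%N || (digit_val (t k) <= nmarked t k)%N.

Lemma nmarkedS t k : nmarked t k.+1 = (nmarked t k + marked t k)%N.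
Proof. by []. Qed.

Lemma nmarked_gt0 t k : (0 < nmarked t k.+1)%N.
Proof.
by elim: k => [//|k IH]; rewrite nmarkedS; exact: leq_trans IH (leq_addr _ _).
Qed.

Lemma nmarked_le t k : (nmarked t k <= k)%N.
Proof.
elim: k => [//|k IH]; rewrite nmarkedS -addn1.
by apply: leq_add => //; case: (marked t k).
Qed.

Definition Lambda_val (t : triangular) (k : nat) : nat :=
  if marked t k.+1 then digit_val (t k.+1) else (digit_val (t k.+1)).-1.

Lemma Lambda_subproof t k : (0 < Lambda_val t k <= k.+1)%N.
Proof.
rewrite /Lambda_val /marked orFb; have /andP[t0 tk] := valP (t k.+1).
case: ifPn => [td|]; first by rewrite t0 (leq_trans td (nmarked_le _ _)).
rewrite -ltnNge => dt; apply/andP; split; last by rewrite -ltnS prednK.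
by rewrite -ltnS prednK//; exact: leq_ltn_trans (nmarked_gt0 t k) dt.
Qed.

Definition Lambda (t : triangular) : triangular :=
  fun k => exist _ (Lambda_val t k) (Lambda_subproof t k).

Definition J_val (R : realType) (x : Iinf R) (k : nat) : nat :=
  #|[set i : 'I_k.+1 | uval (x i) <= uval (x k)]%SET|.

Lemma J_subproof R (x : Iinf R) k : (0 < J_val x k <= k.+1)%N.
Proof.
apply/andP; split; last by rewrite -[leqRHS]card_ord max_card.
by apply/card_gt0P; exists ord_max; rewrite inE lexx.
Qed.

(* This formula is total; only its values on [distinct_coords R], a set of full
   measure, are relevant. *)
Definition J (R : realType) (x : Iinf R) : triangular :=
  fun k => exist _ (J_val x k) (J_subproof x k).

Definition weyl_cell (R : realType) (n : nat) (r : rel 'I_n) :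
    set ('I_n -> unitI R) :=
  [set y | [/\ forall i, 0 < uval (y i) < 1,
               injective y
             & forall i j, (uval (y i) < uval (y j)) = r i j]].

(* A relation r that is not a strict total order gives an empty cell. *)
Definition open_weyl_simplices (R : realType) (n : nat) :
    set (set ('I_n -> unitI R)) :=
  [set W | W !=set0 /\ exists r : rel 'I_n, W = weyl_cell r].
Arguments open_weyl_simplices : clear implicits.

Definition cylinder (R : realType) (n : nat) (W : set ('I_n -> unitI R)) :
    set (Iinf R) :=
  [set x | W (fun i : 'I_n => x i)].

Definition weyl_partition (R : realType) (n : nat) : set (set (Iinf R)) :=
  [set cylinder W | W in open_weyl_simplices R n].
Arguments weyl_partition : clear implicits.

(* Main.v *)
(* J intertwines S and Lambda because position n + 1 is marked by J x exactly
   when x_(n+1) < x_1: the number d_n of marked positions is the rank of x_1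
   among x_1, ..., x_n. The same comparison at any other position k shows that
   J x determines the order pattern of x.

   J carries m^infty to mu: if x has pairwise distinct coordinates, its n!
   rearrangements under permutations of the first n positions lie in distinct
   cells of prescribed first n ranks, and m^infty is invariant under these
   rearrangements, so each cell has measure at most 1/n!. This is the mu-measure
   of a cylinder of length n; two probabilities one of which is dominated by the
   other on all cylinders of length n agree on them.

   J is invertible mod 0: by the law of large numbers the frequency of the
   indices i <= n with x_i <= q tends to q for every rational q, so the
   normalized rank of x_k among x_1, ..., x_n tends to x_k. Second moments are
   summable along n = 2^j, which is all that is needed. Hence x is a measurable
   function of J x, and the order patterns of x separate points. *)

Require Import Defs.
From HB Require Import structures.
From mathcomp Require Import all_boot all_order all_algebra fingroup perm.
From mathcomp Require Import all_classical all_reals all_analysis.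
From mathcomp Require Import measurable_realfun zify lra.

Set Implicit Arguments.
Unset Strict Implicit.
Unset Printing Implicit Defensive.

Import Order.TTheory GRing.Theory Num.Theory.
Import numFieldNormedType.Exports.

Local Open Scope classical_set_scope.
Local Open Scope ring_scope.

(** * Measures on countable products *)

(* [probability_setT] for the coercion of a probability to a measure, which
   [rewrite] does not identify with the coercion to a set function. *)
Lemma measure_probability_setT (R : realType) d (X : measurableType d)
    (P : probability X R) : (P : {measure set X -> \bar R}) setT = 1%E.
Proof. exact: probability_setT. Qed.

Lemma measurable_preimage d d' (X : measurableType d) (Y : measurableType d')
    (f : X -> Y) (D : set Y) :
  measurable_fun setT f -> measurable D -> measurable (f @^-1` D).
Proof. by move=> mf mD; rewrite -[X in measurable X]setTI; exact: mf. Qed.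

Section countprod_theory.
Context {d : measure_display} {T : nat -> measurableType d}.

Lemma measurable_coord k : measurable_fun setT (fun x : countprod T => x k).
Proof.
move=> _ A mA; apply: sub_sigma_algebra; exists k => //.
by exists A.
Qed.

Lemma measurable_countprod d' (X : measurableType d') (f : X -> countprod T) :
  (forall k, measurable_fun setT (fun x => f x k)) -> measurable_fun setT f.
Proof.
move=> mf; apply: (@measurability _ _ _ _ setT f
  (\bigcup_k preimage_set_system setT (fun x : countprod T => x k) measurable)).
  by [].
move=> _ [_ [k _ [A mA <-]] <-].
by rewrite !setTI; have := mf k measurableT A mA; rewrite setTI.
Qed.

Definition box (n : nat) (A : forall k, set (T k)) : set (countprod T) :=
  [set x | forall k, (k < n)%N -> A k (x k)].

Lemma measurable_box n A : (forall k, measurable (A k)) -> measurable (box n A).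
Proof.
move=> mA.
have -> : box n A = \bigcap_(k in `I_n) [set x : countprod T | A k (x k)].
  by apply/seteqP; split=> x h k /h.
apply: bigcap_measurableType => k _.
by have := @measurable_coord k measurableT (A k) (mA k); rewrite setTI.
Qed.

Definition boxes : set (set (countprod T)) :=
  [set D | exists n, exists2 A : forall k, set (T k),
     forall k, measurable (A k) & box n A = D].

(** Boxes are closed under intersection (the shorter one is padded with whole spaces) and generate
    the sigma-algebra, so the pi-lambda uniqueness theorem applies. *)
Lemma countprod_measure_unique (R : realType)
    (P Q : {measure set (countprod T) -> \bar R}) :
  (forall n A, (forall k, measurable (A k)) -> P (box n A) = Q (box n A)) ->
  (P setT < +oo)%E -> forall D, measurable D -> P D = Q D.
Proof.
move=> PQ Pfin D mD.
have boxI : setI_closed boxes.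
  move=> _ _ [n [A mA <-]] [m [B mB <-]].
  exists (maxn n m); exists (fun k => (if (k < n)%N then A k else setT) `&`
    (if (k < m)%N then B k else setT)).
    by move=> k; apply: measurableI; case: ifP.
  apply/seteqP; split => [x xAB|x [xA xB] k knm].
    split => k kn; have := xAB k; rewrite leq_max kn ?orbT => /(_ isT) [] //.
  by split; case: ifPn => // kn; [exact: xA|exact: xB].
have boxT : boxes setT.
  exists 0%N; exists (fun=> setT) => //.
  by apply/seteqP; split => // x _ k.
apply: (measure_unique boxes (fun=> setT)) => //.
- apply/seteqP; split; last first.
    apply: smallest_sub; first exact: sigma_algebra_measurable.
    by move=> _ [n [A mA <-]]; exact: measurable_box.
  apply: smallest_sub; first exact: smallest_sigma_algebra.
  move=> _ [k _ [A mA <-]]; apply: sub_sigma_algebra; exists k.+1.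
  (* A at coordinate k, the whole space at the others *)
  have mAk : forall j, measurable ([set y : T j | forall e : j = k,
      A (eq_rect j (fun j => T j : Type) y k e)]).
    move=> j; have [jk|/eqP jk] := eqVneq j k.
      subst j; rewrite (_ : [set _ | _] = A)//.
      apply/seteqP; split=> [y /(_ erefl)//|y Ay e].
      by rewrite (eq_irrelevance e erefl).
    rewrite (_ : [set _ | _] = setT)//.
    by apply/seteqP; split=> // y _ e.
  exists (fun j => [set y : T j | forall e : j = k,
      A (eq_rect j (fun j => T j : Type) y k e)]) => //.
  rewrite setTI; apply/seteqP; split=> [x /(_ k (ltnSn k) erefl)//|x Ax j _ /= e].
  by subst j.
- by rewrite bigcup_const.
- by move=> _ [n [A mA <-]]; exact: PQ.
Qed.

Lemma countprod_pushforward_unique (R : realType) d' (X : measurableType d')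
    (P : probability X R) (Q : {measure set (countprod T) -> \bar R})
    (f : X -> countprod T) :
  measurable_fun setT f ->
  (forall n A, (forall k, measurable (A k)) -> P (f @^-1` box n A) = Q (box n A)) ->
  forall D, measurable D -> P (f @^-1` D) = Q D.
Proof.
move=> mf PQ D mD.
pose P' := measure_function_pushforward__canonical__measure_function_Measure P mf.
apply: (@countprod_measure_unique _ P' Q) => //.
by have := probability_setT P; rewrite /= /pushforward preimage_setT => ->; rewrite ltry.
Qed.
End countprod_theory.

(** * Powers of a probability *)

Section iid.
Context {R : realType} {d : measure_display} {U : measurableType d}.
Variables (m : probability U R) (P : probability (countprod (fun=> U)) R).
Hypothesis mP : is_product_measure (fun=> m) P.

Lemma product_box n (A : nat -> set U) : (forall k, measurable (A k)) ->
  P (@box _ (fun=> U) n A) = (\prod_(k < n) m (A k))%E.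
Proof. by move=> mA; exact: mP. Qed.

Definition precomp (f : nat -> nat) (x : countprod (fun=> U)) :
  countprod (fun=> U) := fun k => x (f k).

Lemma measurable_precomp f : measurable_fun setT (precomp f).
Proof. by apply: measurable_countprod => k; exact: measurable_coord. Qed.

(** The preimage of a box is a box with the side [A k] moved to coordinate [f k] and whole spaces
    elsewhere; injectivity of [f] keeps two sides from meeting at one coordinate. *)
Lemma precomp_preserving f : injective f -> measure_preserving P (precomp f).
Proof.
move=> f_inj; split; first exact: measurable_precomp.
apply: (@countprod_pushforward_unique _ _ _ _ _ P P).
- exact: measurable_precomp.
- move=> n A mA; apply: (etrans _ (esym (product_box n mA))).
  pose N := \max_(k < n) (f k).+1.
  pose A' j : set U := [set y | forall k, (k < n)%N -> f k = j -> A k y].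
  have A'f k : (k < n)%N -> A' (f k) = A k.
    move=> kn; apply/seteqP; split => [y /(_ k kn erefl)//|y Ay l _ /f_inj ->//].
  have A'T j : j \notin [seq f k | k <- iota 0 n] -> A' j = setT.
    move=> jf; apply/seteqP; split => // y _ k kn fkj; move/negP: jf; case.
    by apply/mapP; exists k; rewrite ?mem_iota.
  have mA' j : measurable (A' j).
    have [|/A'T ->//] := boolP (j \in [seq f k | k <- iota 0 n]).
    by move=> /mapP[k]; rewrite mem_iota /= => kn ->; rewrite A'f.
  have -> : precomp f @^-1` box n A = box N A'.
    apply/seteqP; split => [x xA j jN k kn fkj|x xA k kn].
      by rewrite -fkj; exact: xA.
    apply: (xA (f k) _ k kn erefl).
    exact: (@leq_bigmax_cond _ xpredT (fun k : 'I_n => (f k).+1) (Ordinal kn)).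
  apply: (etrans (product_box N mA')); rewrite -(big_mkord xpredT (fun j => m (A' j))).
  rewrite (bigID (fun j => j \in [seq f k | k <- iota 0 n]))/=.
  rewrite [X in (_ * X)%E]big1 ?mule1; last first.
    by move=> j jf; rewrite A'T// probability_setT.
  rewrite -big_filter (perm_big [seq f k | k <- iota 0 n]).
    rewrite big_map -[in iota 0 n](subn0 n) -/(index_iota 0 n) big_mkord.
    by apply: eq_bigr => k _; rewrite A'f.
  apply: uniq_perm; first by rewrite filter_uniq ?iota_uniq.
    by rewrite map_inj_uniq ?iota_uniq.
  move=> j; rewrite mem_filter andb_idr// => /mapP[k].
  rewrite mem_iota mem_index_iota /= => kn ->.
  exact: (@leq_bigmax_cond _ xpredT (fun k : 'I_n => (f k).+1) (Ordinal kn)).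
Qed.

Lemma coord_law k A : measurable A -> P [set x | A (x k)] = m A.
Proof.
move=> mA; have [_ pres] := @precomp_preserving (fun j => k + j)%N (@addnI k).
have := @product_box 1 (fun=> A) (fun=> mA); rewrite big_ord1 => <-.
rewrite -[RHS]pres; last exact: (@measurable_box _ (fun=> U) 1 (fun=> A) (fun=> mA)).
congr (P _); apply/seteqP; split => [x xA j /=|x /(_ 0%N isT)].
  by rewrite ltnS leqn0 => /eqP ->; rewrite /precomp addn0.
by rewrite /= /precomp addn0.
Qed.

Lemma coord_law2 i j A B : i != j -> measurable A -> measurable B ->
  P [set x | A (x i) /\ B (x j)] = (m A * m B)%E.
Proof.
move=> ij mA mB.
(* an injection with f 0 = i and f 1 = j *)
pose f k := if k is l.+2 then (i + j + l).+1 else if k is 1 then j else i.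
have f_inj : injective f.
  by move/eqP : ij => ij [|[|k]] [|[|l]]; rewrite /f => fkl; move: fkl ij; lia.
have [_ pres] := precomp_preserving f_inj.
pose AB k : set U := if k is 0%N then A else B.
have mAB k : measurable (AB k) by case: k.
have := product_box 2 mAB; rewrite big_ord_recr big_ord1 /= => <-.
rewrite -[RHS]pres; last exact: (@measurable_box _ (fun=> U) 2 AB mAB).
congr (P _); apply/seteqP; split => [x [xA xB] [|[|]]//|x xAB].
by split; [exact: (xAB 0%N)|exact: (xAB 1%N)].
Qed.

End iid.

(** * A law of large numbers along powers of two *)

Section orthogonal_sums.
Context {R : realType} {d : measure_display} {X : measurableType d}.
Variables (P : probability X R) (Z : nat -> X -> R).
Hypothesis mZ : forall i, measurable_fun setT (Z i).
Hypothesis Z1 : forall i x, `|Z i x| <= 1.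
Hypothesis Zorth : forall i j, i != j -> (\int[P]_x (Z i x * Z j x)%:E = 0)%E.

Let mS n : measurable_fun setT (fun x => \sum_(i < n) Z i x).
Proof. exact: measurable_sum. Qed.

Let intZZ i j : P.-integrable setT (fun x => (Z i x * Z j x)%:E).
Proof.
apply: (@measurable_bounded_integrable _ _ _ P (fun x => Z i x * Z j x)) => //.
- by rewrite measure_probability_setT ltry.
- exact: measurable_funM.
- exists 1; split => // M M1 x _ /=; rewrite normrM (le_trans _ (ltW M1))//.
  by rewrite mulr_ile1.
Qed.

(** Orthogonality kills the off-diagonal terms of the square; each of the [n] diagonal terms is at
    most 1. *)
Lemma second_moment_le n : (\int[P]_x ((\sum_(i < n) Z i x) ^+ 2)%:E <= n%:R%:E)%E.
Proof.
have -> : (fun x => ((\sum_(i < n) Z i x) ^+ 2)%:E) =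
    (fun x => \sum_(i < n) \sum_(j < n) (Z i x * Z j x)%:E)%E.
  apply/funext => x; rewrite expr2 mulr_suml -sumEFin; apply: eq_bigr => i _.
  by rewrite mulr_sumr -sumEFin.
rewrite integral_sum//; last by move=> i; exact: integrable_sum.
apply: (@le_trans _ _ (\sum_(i < n) 1)%E); last first.
  by rewrite sumEFin lee_fin sumr_const card_ord.
apply: lee_sum => i _; rewrite integral_sum// (bigD1 i)//= big1 ?adde0.
  apply: (@le_trans _ _ (\int[P]_x (cst 1%E x))%E); last first.
    by rewrite integral_cst// measure_probability_setT mule1.
  apply: ge0_le_integral => //.
  - by move=> x _; rewrite lee_fin -expr2 sqr_ge0.
  - by apply/measurable_EFinP; exact: measurable_funM.
  - by move=> x _; rewrite lee_fin -expr2 -real_normK ?num_real// expr_le1.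
by move=> j ji; rewrite Zorth// eq_sym.
Qed.

(** The averages over [2 ^ k] terms have second moments at most [1 / 2 ^ k], which are summable. So
    the sum of their squares is integrable, hence finite almost everywhere, and its terms tend to
    0. *)
Lemma dyadic_averages_cvg0 :
  {ae P, forall x, (\sum_(i < 2 ^ k) Z i x) / (2 ^ k)%:R @[k --> \oo] --> (0 : R)}.
Proof.
pose V k x := ((\sum_(i < 2 ^ k) Z i x) / (2 ^ k)%:R) ^+ 2.
have V0 k x : 0 <= V k x by exact: sqr_ge0.
have mV k : measurable_fun setT (fun x => (V k x)%:E).
  by apply/measurable_EFinP; apply: measurable_funX; exact: measurable_funM.
(* The bound [1 / 2 ^ k] is written [2 / 2 ^ k.+1], the form summed by [epsilon_trick0]. *)
have intV k : (\int[P]_x (V k x)%:E <= (2 / (2 ^ k.+1)%:R)%:E)%E.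
  have -> : (fun x => (V k x)%:E) = (fun x =>
      ((\sum_(i < 2 ^ k) Z i x) ^+ 2)%:E * (((2 ^ k)%:R ^- 2)%:E))%E.
    by apply/funext => x; rewrite /V exprMn exprVn EFinM.
  have V20 : (0 <= ((2 ^ k)%:R ^- 2)%:E :> \bar R)%E.
    by rewrite lee_fin invr_ge0 exprn_ge0.
  have mS2 : measurable_fun setT (fun x => ((\sum_(i < 2 ^ k) Z i x) ^+ 2)%:E).
    by apply/measurable_EFinP; exact: measurable_funX.
  rewrite ge0_integralZr//; last by move=> x _; rewrite lee_fin sqr_ge0.
  apply: (@le_trans _ _ ((2 ^ k)%:R%:E * ((2 ^ k)%:R ^- 2)%:E)%E).
    by apply: lee_wpmul2r => //; exact: second_moment_le.
  have x0 : (2 ^ k)%:R != 0 :> R by rewrite pnatr_eq0 expn_eq0.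
  have -> : 2 / (2 ^ k.+1)%:R = (2 ^ k)%:R^-1 :> R.
    by rewrite expnS natrM invfM mulrA divff ?mul1r.
  by rewrite -EFinM lee_fin expr2 invfM mulrA divff ?mul1r.
have intSV : P.-integrable setT (fun x => \sum_(k <oo) (V k x)%:E)%E.
  apply/integrableP; split.
    apply: ge0_emeasurable_sum => // k x _ _; exact: V0.
  under eq_integral.
    move=> x _; rewrite gee0_abs; last by apply: nneseries_ge0 => k _ _; exact: V0.
    over.
  rewrite integral_nneseries//; last by move=> k x _; exact: V0.
  apply: (@le_lt_trans _ _ (\sum_(k <oo) (2 / (2 ^ k.+1)%:R)%:E)%E).
    apply: lee_nneseries => [k _ _|k _]; last exact: intV.
    by apply: integral_ge0 => x _; exact: V0.
  apply: le_lt_trans (epsilon_trick0 xpredT _) _; rewrite ?ltry//.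
have := integrable_ae measurableT intSV; apply: filterS => x /(_ I) finx.
have cvV : cvgn (series (V ^~ x)).
  have /cvg_ex[l cl] := @is_cvg_nneseries R (fun k => (V k x)%:E) xpredT 0
    (fun k _ _ => V0 k x).
  move: finx; rewrite (cvg_lim _ cl)// => /fineK lE; move: cl; rewrite -lE.
  move=> /fine_cvg cl; apply/cvg_ex; exists (fine l); move: cl.
  by under eq_fun do rewrite /= sumEFin.
have V_cvg0 := cvg_series_cvg_0 cvV.
apply: norm_cvg0; rewrite -[X in _ --> X](@sqrtr0 R).
have <- : Num.sqrt \o (V ^~ x) =
    fun k => `|(\sum_(i < 2 ^ k) Z i x) / (2 ^ k)%:R|.
  by apply/funext => k /=; rewrite /V sqrtr_sqr.
exact: cvg_comp V_cvg0 (@sqrt_continuous R 0).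
Qed.
End orthogonal_sums.

(** * Frequencies of visits to a set *)

Section frequencies.
Context {R : realType} {d : measure_display} {U : measurableType d}.
Variables (m : probability U R) (P : probability (countprod (fun=> U)) R).
Hypothesis mP : is_product_measure (fun=> m) P.
Variable E : set U.
Hypothesis mE : measurable E.
Let X : measurableType _ := countprod (fun=> U).
Let p := fine (m E).
Let F i : set X := [set x | E (x i)].
Let Z i (x : X) : R := \1_(F i) x - p.

Let mF i : measurable (F i).
Proof. by rewrite -[F i]setTI; exact: (@measurable_coord _ (fun=> U) i). Qed.

Let pE : m E = p%:E.
Proof. by rewrite fineK// fin_num_measure. Qed.

Let p01 : 0 <= p <= 1.
Proof.
by rewrite -!lee_fin -pE; apply/andP; split; rewrite ?measure_ge0 ?probability_le1.
Qed.

Let mZ i : measurable_fun setT (Z i).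
Proof. by apply: measurable_funB => //; exact: measurable_indic. Qed.

Let Z1 i x : `|Z i x| <= 1.
Proof.
by move/andP : p01 => [p0 p1]; rewrite /Z indicE ler_norml; case: (_ \in _) => /=; lra.
Qed.

Let int1 A : measurable A -> P.-integrable setT (EFin \o (\1_A : X -> R)).
Proof. exact: integrable_indic. Qed.

Let Rint1 A : measurable A -> (\int[P]_x (\1_A x) = fine (P A) :> R)%R.
Proof. by move=> mA; rewrite /Rintegral integral_indic// setIT. Qed.

Let Zorth i j : i != j -> (\int[P]_x (Z i x * Z j x)%:E = 0)%E.
Proof.
move=> ij; have mFF : measurable (F i `&` F j) by exact: measurableI.
(* [h] is the product expanded, with the product of the indicators as the indicator of the
   intersection. By pairwise independence its integral is [(p * p + p * p) - (p * p + p * p)]. *)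
pose h x : R := (\1_(F i `&` F j) x + p * p) - (p * \1_(F i) x + p * \1_(F j) x).
have -> : (fun x => (Z i x * Z j x)%:E) = EFin \o h.
  apply/funext => x; rewrite /Z /h /= !indicE in_setI.
  by congr EFin; case: (_ \in _); case: (_ \in _) => /=; lra.
have intc : P.-integrable setT (EFin \o (fun=> p * p)).
  exact: finite_measure_integrable_cst.
have intp k : P.-integrable setT (EFin \o (fun x => p * \1_(F k) x)).
  by have := integrableZl measurableT p (int1 (mF k)).
have inta : P.-integrable setT (EFin \o (fun x => \1_(F i `&` F j) x + p * p)).
  exact: (integrableD measurableT (int1 mFF) intc).
have intb : P.-integrable setT (EFin \o (fun x => p * \1_(F i) x + p * \1_(F j) x)).
  exact: (integrableD measurableT (intp i) (intp j)).
have inth : P.-integrable setT (EFin \o h).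
  exact: (integrableB measurableT inta intb).
rewrite -[LHS]fineK ?integrable_fin_num// -[fine _]/(Rintegral P setT h).
rewrite RintegralB// (RintegralD measurableT (int1 mFF) intc).
rewrite (RintegralD measurableT (intp i) (intp j)).
rewrite (RintegralZl p measurableT (int1 (mF i))).
rewrite (RintegralZl p measurableT (int1 (mF j))).
rewrite (Rintegral_cst P measurableT (p * p)) (Rint1 mFF) !(Rint1 (mF _)).
have PF k : P (F k) = p%:E by rewrite -pE; exact: (coord_law mP k mE).
have PFF : P (F i `&` F j) = (p * p)%:E.
  by rewrite EFinM -pE; exact: (coord_law2 mP ij mE mE).
rewrite measure_probability_setT.
have -> : fine (P (F i `&` F j)) = p * p by rewrite PFF.
have -> : fine (P (F i)) = p by rewrite PF.
have -> : fine (P (F j)) = p by rewrite PF.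
by rewrite /= mulr1 subrr.
Qed.

Lemma frequency_cvg :
  {ae P, forall x : X, (\sum_(i < 2 ^ k) \1_E (x i)) / (2 ^ k)%:R @[k --> \oo] -->
    fine (m E)}.
Proof.
apply: filterS (dyadic_averages_cvg0 mZ Z1 Zorth) => x.
move=> /(cvgD (@cvg_cst _ p _ \oo _)); rewrite addr0 => cv.
apply: cvg_trans cv; apply: near_eq_cvg; apply: nearW => k /=.
rewrite fctE /Z sumrB sumr_const card_ord mulrBl -(mulr_natr p).
rewrite mulfK ?pnatr_eq0 ?expn_eq0//.
by rewrite addrC subrK; congr (_ / _); apply: eq_bigr => i _; rewrite !indicE.
Qed.

End frequencies.

(** * Ranks *)

Section ranks.
Context {R : realType}.
Implicit Types (x y : Iinf R) (t : triangular).

(** The threshold is an arbitrary real: at a coordinate of [x] it yields a rank, at a rational the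
    unnormalized empirical distribution function. *)
Definition count_le x (a : R) (n : nat) : nat := (\sum_(i < n) (uval (x i) <= a)%R)%N.

Lemma count_leS x a n : count_le x a n.+1 = (count_le x a n + (uval (x n) <= a)%R)%N.
Proof. by rewrite /count_le big_ord_recr. Qed.

Lemma leq_count_le x a b n : a <= b -> (count_le x a n <= count_le x b n)%N.
Proof.
move=> ab; apply: leq_sum => i _; case: (leP _ a) => // xa.
by rewrite (le_trans xa ab).
Qed.

Lemma ltn_count_le x a n k : (k < n)%N -> a < uval (x k) ->
  (count_le x a n < count_le x (uval (x k)) n)%N.
Proof.
move=> kn ax; rewrite /count_le (bigD1 (Ordinal kn))//= [ltnRHS](bigD1 (Ordinal kn))//=.
rewrite lexx leNgt ax add0n add1n ltnS; apply: leq_sum => i _.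
by case: (leP _ a) => // xa; rewrite (le_trans xa (ltW ax)).
Qed.

Lemma J_valE x k : J_val x k = count_le x (uval (x k)) k.+1.
Proof.
rewrite /J_val /count_le -sum1_card big_mkcond /=.
by apply: eq_bigr => i _; rewrite inE; case: (_ <= _).
Qed.

Lemma uval_inj : injective (@uval R).
Proof. by move=> u v /val_inj. Qed.

(** If [x n] lies below [x k], the term [x k] is counted only on the right, which makes up for [x n]
    counting itself on the left; otherwise monotonicity of the count decides. *)
Lemma leq_J_count_le x k n : injective x -> (k < n)%N ->
  (digit_val (J x n) <= count_le x (uval (x k)) n)%N = (uval (x n) <= uval (x k)).
Proof.
move=> x_inj kn; rewrite [digit_val _]J_valE count_leS lexx addn1.
case: leP => [|xkn].
  rewrite le_eqVlt => /predU1P[/uval_inj/x_inj nk|xnk]; first by rewrite nk ltnn in kn.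
  exact: ltn_count_le.
by apply/negbTE; rewrite -leqNgt leq_count_le// ltW.
Qed.

(* [rank_in t k n] is the rank of position k + 1 among the first n positions,
   computed from the sequence t of ranks; each new term t_(n+1) that does not
   exceed the current rank pushes it up by one. Junk value 0 for n <= k. *)
Fixpoint rank_in t (k n : nat) : nat :=
  if n is n'.+1 then
    if (n' <= k)%N then (if n' == k then digit_val (t k) else 0%N)
    else (rank_in t k n' + (digit_val (t n') <= rank_in t k n'))%N
  else 0%N.

Lemma rank_in_J x k n : injective x -> (k < n)%N ->
  rank_in (J x) k n = count_le x (uval (x k)) n.
Proof.
move=> x_inj; elim: n => // n IH; rewrite ltnS /= leq_eqVlt => /predU1P[->|kn].
  by rewrite leqnn eqxx [LHS]J_valE.
by rewrite leqNgt kn /= IH// leq_J_count_le// count_leS.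
Qed.

Lemma eq_rank_in t t' k n : (forall i, (i < n)%N -> t i = t' i) ->
  rank_in t k n = rank_in t' k n.
Proof.
elim: n => //= n IH tt'; rewrite IH; last by move=> i /ltnW; exact: tt'.
rewrite [t n]tt'//; case: ifPn => //; case: eqP => // nk.
by rewrite -nk tt'.
Qed.

(** For [i < j], the first [j] ranks give the current rank of [x i] through [rank_in], and comparing
    it with [J x j] orders [x i] and [x j]. *)
Lemma eq_J_order x y n : injective x -> injective y ->
  (forall i, (i < n)%N -> J x i = J y i) ->
  forall i j, (i < n)%N -> (j < n)%N ->
  (uval (x i) < uval (x j)) = (uval (y i) < uval (y j)).
Proof.
move=> x_inj y_inj Jxy.
have ltJ i j : (i < j)%N -> (j < n)%N ->
    (uval (x j) <= uval (x i)) = (uval (y j) <= uval (y i)).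
  move=> ij jn; rewrite -!leq_J_count_le// -!rank_in_J// Jxy//.
  rewrite (@eq_rank_in (J x) (J y))// => l lj.
  by rewrite Jxy// (ltn_trans lj).
move=> i j i_n j_n; have [ij|ji|->] := ltngtP i j; last by rewrite !ltxx.
  by rewrite !ltNge ltJ.
rewrite !lt_neqAle ltJ//; congr (~~ _ && _).
by apply/eqP/eqP => /uval_inj => [/x_inj|/y_inj] ij; rewrite ij ltnn in ji.
Qed.

Lemma nmarked_J x n : injective x -> nmarked (J x) n = count_le x (uval (x 0%N)) n.
Proof.
move=> x_inj; elim: n => [|n IH]; first by rewrite /count_le big_ord0.
rewrite nmarkedS count_leS IH /marked IH; congr (_ + nat_of_bool _)%N.
by case: n {IH} => [|n]; [rewrite lexx|rewrite leq_J_count_le].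
Qed.

Lemma marked_J x n : injective x -> marked (J x) n = (uval (x n) <= uval (x 0%N)).
Proof.
move=> x_inj; rewrite /marked nmarked_J//.
by case: n => [|n]; [rewrite lexx|rewrite leq_J_count_le].
Qed.

(** Deleting the first term lowers the rank of a later one exactly when the first term is the
    smaller, that is, when the position of the later one is unmarked; [Lambda] subtracts 1 in that
    case. *)
Lemma J_shift x : injective x -> J (bernoulli_shift x) = Lambda (J x).
Proof.
move=> x_inj; apply: functional_extensionality_dep => k; apply: val_inj => /=.
rewrite /Lambda_val marked_J// J_valE [digit_val _]J_valE.
rewrite {2 3}/count_le big_ord_recl /=.
have xk0 : uval (x k.+1) != uval (x 0%N) by apply/eqP => /uval_inj/x_inj.
case: leP => [|x0k]; last by rewrite (ltW x0k).
by rewrite le_eqVlt (negbTE xk0) /= => xk; rewrite leNgt xk.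
Qed.

End ranks.

(** * Measurability *)

Section finitely_determined.
Context {d : measure_display} {X : measurableType d}.

Lemma measurable_finite_fibers (F : finType) (f : X -> F) (D : set X) :
  (forall a, measurable (f @^-1` [set a])) ->
  (forall x y, f x = f y -> D x -> D y) -> measurable D.
Proof.
move=> mf fD; have -> : D = \bigcup_(a in f @` D) f @^-1` [set a].
  apply/seteqP; split=> [x Dx|x [_ [y Dy <-] /= fxy]].
    by exists (f x) => //; exists x.
  by apply: fD Dy.
by apply: fin_bigcup_measurable => *; [exact: finite_finset|exact: mf].
Qed.

Lemma measurable_finfun_fibers (I F : finType) (f : I -> X -> F) (D : set X) :
  (forall i a, measurable (f i @^-1` [set a])) ->
  (forall x y, (forall i, f i x = f i y) -> D x -> D y) -> measurable D.
Proof.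
move=> mf fD; apply: (@measurable_finite_fibers _ (fun x => [ffun i => f i x])).
  move=> a; rewrite (_ : _ @^-1` _ = \bigcap_(i in [set: I]) f i @^-1` [set a i]).
    by apply: fin_bigcap_measurable => *; [exact: finite_finset|exact: mf].
  apply/seteqP; split=> [x /= <- i _ /=|x xa]; first by rewrite ffunE.
  by apply/ffunP => i; rewrite ffunE; exact: xa.
by move=> x y /ffunP fxy; apply: fD => i; have := fxy i; rewrite !ffunE.
Qed.

Lemma measurable_bits (I : finType) (b : I -> X -> bool) (D : set X) :
  (forall i, measurable [set x | b i x]) ->
  (forall x y, (forall i, b i x = b i y) -> D x -> D y) -> measurable D.
Proof.
move=> mb bD; apply: (@measurable_finfun_fibers I bool b D _ bD) => i; case.
  by rewrite (_ : _ @^-1` _ = [set x | b i x]).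
rewrite (_ : _ @^-1` _ = ~` [set x | b i x]); first exact: measurableC.
by apply/seteqP; split => x /=; case: (b i x).
Qed.

End finitely_determined.

(** * Events determined by finitely many ranks *)

Section triangular_measurability.
Implicit Types t : triangular.

Definition determined_by (T : Type) n (h : triangular -> T) :=
  forall t t', (forall i, (i < n)%N -> t i = t' i) -> h t = h t'.

(** A code of the first [n] terms in a finite type; [inord] loses nothing because each of them is at
    most [n]. *)
Definition digits n t : {ffun 'I_n -> 'I_n.+1} :=
  [ffun i : 'I_n => inord (digit_val (t i))].

Lemma digits_inj n t t' : digits n t = digits n t' ->
  forall i, (i < n)%N -> t i = t' i.
Proof.
move=> /ffunP tt' i i_n; have := tt' (Ordinal i_n); rewrite !ffunE /=.
move=> /(congr1 (@nat_of_ord _)); rewrite !inordK; first by move/val_inj.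
  by have /andP[_ /leq_ltn_trans] := valP (t' i); apply.
by have /andP[_ /leq_ltn_trans] := valP (t i); apply.
Qed.

Lemma measurable_digits n a : measurable [set t | digits n t = a].
Proof.
apply: (@measurable_finfun_fibers _ _ 'I_n 'I_n.+1
  (fun i t => inord (digit_val (t i)))).
  move=> i b; rewrite -[X in measurable X]setTI.
  exact: (@measurable_coord _ digit i measurableT
    [set s | inord (digit_val s) = b]).
by move=> t t' tt' <-; apply/ffunP => i; rewrite !ffunE tt'.
Qed.

Lemma measurable_determined n (D : set triangular) :
  determined_by n D -> measurable D.
Proof.
move=> nD; apply: (@measurable_finite_fibers _ _ _ (digits n)).
  by move=> a; exact: measurable_digits.
by move=> t t' /digits_inj tt'; rewrite (nD _ _ tt').
Qed.

Lemma measurable_fun_determined d (Y : measurableType d) n (h : triangular -> Y) :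
  determined_by n h -> measurable_fun setT h.
Proof.
move=> nh _ B mB; rewrite setTI; apply: (@measurable_determined n).
by move=> t t' tt'; rewrite /preimage /= (nh _ _ tt').
Qed.

End triangular_measurability.

(** * Measurability of coordinates, ranks and distinctness *)

Section unit_interval_measurability.
Context {R : realType}.

Lemma measurable_uval : measurable_fun setT (@uval R).
Proof. by move=> _ B mB; exists B. Qed.

Lemma measurable_unitI d (Y : measurableType d) (f : Y -> unitI R) :
  measurable_fun setT (fun y => uval (f y)) -> measurable_fun setT f.
Proof.
by move=> mf _ _ [B mB <-]; rewrite setTI; have := mf measurableT B mB.
Qed.

Lemma measurable_ucoord i : measurable_fun setT (fun x : Iinf R => uval (x i)).
Proof.
exact: measurableT_comp measurable_uval (@measurable_coord _ (fun=> unitI R) i).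
Qed.

Lemma measurable_lt_coord i j : measurable [set x : Iinf R | uval (x i) < uval (x j)].
Proof.
have mij := measurable_fun_ltr (@measurable_ucoord i) (@measurable_ucoord j).
by have := mij measurableT [set true] I; rewrite setTI.
Qed.

Lemma measurable_le_coord i j : measurable [set x : Iinf R | uval (x i) <= uval (x j)].
Proof.
have mij := measurable_fun_ler (@measurable_ucoord i) (@measurable_ucoord j).
by have := mij measurableT [set true] I; rewrite setTI.
Qed.

Lemma measurable_J : measurable_fun setT (@J R : Iinf R -> triangular).
Proof.
apply: measurable_countprod => k _ B mB; rewrite setTI.
apply: (@measurable_bits _ _ 'I_k.+1 (fun i (x : Iinf R) => uval (x i) <= uval (x k))).
  by move=> i; exact: measurable_le_coord.
move=> x y xy; rewrite /preimage /=; suff -> : J x k = J y k by [].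
apply: val_inj; rewrite /= !J_valE /count_le; apply: eq_bigr => i _.
by rewrite xy.
Qed.

Lemma measurable_distinct_coords : measurable (distinct_coords R).
Proof.
have -> : distinct_coords R = \bigcap_i \bigcap_(j in [set j | j != i])
    ([set x | uval (x i) < uval (x j)] `|` [set x | uval (x j) < uval (x i)]).
  apply/seteqP; split=> [x x_inj i _ j /eqP ji|x xP i j xij].
    apply/orP; rewrite -neq_lt; apply/eqP => /uval_inj/x_inj ij; exact: ji.
  apply/eqP; apply: contraT => ij.
  by have := xP j I i ij; rewrite /= xij ltxx => -[].
apply: bigcap_measurableType => i _; apply: bigcap_measurableType => j _.
by apply: measurableU; exact: measurable_lt_coord.
Qed.

End unit_interval_measurability.

(** * Recovering a sequence from its ranks *)

Section reconstruction.
Context {R : realType}.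
Implicit Types t : triangular.

Lemma rank_in_le t k n : (rank_in t k n <= n)%N.
Proof.
elim: n => //= n IH; case: (leqP n k) => [nk|kn].
  by case: eqP => // ->; have /andP[] := valP (t k).
by rewrite -[leqRHS]addn1 leq_add ?leq_b1.
Qed.

Definition rank_frequency k j t : R := (rank_in t k (2 ^ j))%:R / (2 ^ j)%:R.

Lemma rank_frequency01 k j t : 0 <= rank_frequency k j t <= 1.
Proof.
rewrite /rank_frequency divr_ge0//= ler_pdivrMr ?ltr0n ?expn_gt0// mul1r.
by rewrite ler_nat rank_in_le.
Qed.

Let clampI_subproof (a : R) :
  (Num.max 0 (Num.min a 1) : R) \in [set` `[(0 : R), 1]].
Proof. by rewrite inE /= in_itv /= le_max lexx ge_max ler01 ge_min lexx orbT. Qed.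

Definition clampI (a : R) : unitI R := 
  exist _ (Num.max 0 (Num.min a 1)) (clampI_subproof a).

Lemma uval_clampI a : uval (clampI a) = Num.max 0 (Num.min a 1).
Proof. by []. Qed.

(** The limit superior is measurable in [t] whether or not the frequencies converge, and clamping
    makes it a point of [unitI] by construction. *)
Definition reconstruct t : Iinf R :=
  fun k => clampI (limn_sup (rank_frequency k ^~ t)).

Lemma measurable_reconstruct : measurable_fun setT reconstruct.
Proof.
apply: measurable_countprod => k; apply: measurable_unitI.
apply: (@measurable_maxr _ _ _ _ (cst 0)) => //; apply: measurable_minr => //.
apply: measurable_fun_limn_sup => [t _|t _|j].
- by exists 1 => _ [j _ <-]; have /andP[] := rank_frequency01 k j t.
- by exists 0 => _ [j _ <-]; have /andP[] := rank_frequency01 k j t.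
- apply: (@measurable_fun_determined _ _ (2 ^ j)) => t t' tt'.
  by rewrite /rank_frequency (@eq_rank_in t t').
Qed.

Lemma reconstruct_eq t k (u : unitI R) :
  rank_frequency k ^~ t @ \oo --> (uval u : R) -> reconstruct t k = u.
Proof.
move=> cv; apply: uval_inj; rewrite /reconstruct uval_clampI.
rewrite (cvg_limn_inf_sup cv).2.
have : (uval u : R) \in `[0, 1] by exact: (set_valP u).
by rewrite in_itv /= => /andP[u0 u1]; rewrite min_l// max_r.
Qed.

End reconstruction.

(** * Almost sure properties of the coordinates *)

Section almost_sure_coordinates.
Context {R : realType}.
Variable P : probability (Iinf R) R.
Hypothesis mP : is_product_measure (fun=> lebesgueI R) P.

Lemma lebesgueI_le (q : R) : 0 < q < 1 ->
  lebesgueI R [set u | uval u <= q] = q%:E.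
Proof.
move=> /andP[q0 q1]; rewrite /= /lebesgueI.
have -> : @uval R @` [set u | uval u <= q] = [set` `[0, q]].
  apply/seteqP; split=> [_ [u uq <-]|y].
    have : (uval u : R) \in `[0, 1] by exact: (set_valP u).
    by rewrite /= !in_itv /= uq => /andP[->].
  rewrite /= in_itv /= => /andP[y0 yq].
  have y01 : [set` `[0 : R, 1]] y by rewrite /= in_itv /= y0 (le_trans yq (ltW q1)).
  by exists (exist _ y (mem_set y01)).
by rewrite lebesgue_measure_itv /= lte_fin q0 sube0.
Qed.

Lemma measurable_uval_le (q : R) : measurable [set u : unitI R | uval u <= q].
Proof.
exists [set` `]-oo, q]]; first exact: measurable_itv.
by rewrite setTI; apply/seteqP; split => u; rewrite /= in_itv.
Qed.

Lemma measurable_uval1 (a : R) : measurable [set u : unitI R | uval u = a].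
Proof. by exists [set a]; [exact: measurable_set1|rewrite setTI]. Qed.

Lemma lebesgueI_set1 (a : R) : lebesgueI R [set u | uval u = a] = 0%E.
Proof.
apply/eqP; rewrite -measure_le0 /=.
have <- := @lebesgue_measure_set1 R a; apply: le_measure => //.
- rewrite inE (_ : _ @` _ = [set` `[0 : R, 1]] `&` [set a]).
    by apply: measurableI => //; exact: measurable_itv.
  apply/seteqP; split=> [_ [u ua <-]|y [y01 ya]].
    by split => //; exact: (set_valP u).
  by exists (exist _ y (mem_set y01)).
- by rewrite inE.
- by move=> _ [u ua <-].
Qed.

Lemma ae_coords_in01 : {ae P, forall x : Iinf R, forall k, 0 < uval (x k) < 1}.
Proof.
apply: ae_foralln => k.
have mk (a : R) : measurable [set x : Iinf R | uval (x k) = a].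
  rewrite -[X in measurable X]setTI.
  exact: (@measurable_coord _ (fun=> unitI R) k measurableT _ (measurable_uval1 a)).
have P0 (a : R) : P [set x : Iinf R | uval (x k) = a] = 0%E.
  by rewrite -[RHS](lebesgueI_set1 a) -(coord_law mP k (measurable_uval1 a)).
have N0 a : P.-negligible [set x : Iinf R | uval (x k) = a].
  by apply/negligibleP; [exact: mk|exact: P0].
apply: negligibleS (negligibleU (N0 0) (N0 1)) => x /= xk.
have : (uval (x k) : R) \in `[0, 1] by exact: (set_valP (x k)).
rewrite in_itv /= !le_eqVlt => /andP[/predU1P[<-|x0]]; first by left.
by move=> /predU1P[|x1]; [right|exfalso; apply: xk; rewrite x0 x1].
Qed.

(** For [i != j] the pair of coordinates has the product law, and the diagonal is null for it
    because its sections are points. *)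
Lemma ae_distinct_coords : {ae P, forall x, distinct_coords R x}.
Proof.
suff H : {ae P, forall x : Iinf R, forall i j, i != j -> uval (x i) != uval (x j)}.
  apply: filterS H => x xP i j xij; apply/eqP; apply: contraT => ij.
  by have := xP i j ij; rewrite xij eqxx.
apply: ae_foralln => i; apply: ae_foralln => j.
have [->|ij] := eqVneq i j; first exact: aeW.
pose I2 : measurableType _ := (unitI R * unitI R)%type.
pose f (x : Iinf R) : I2 := (x i, x j).
have mf : measurable_fun setT f.
  by apply: measurable_fun_pair; exact: (@measurable_coord _ (fun=> unitI R)).
pose D : set I2 := [set z | uval z.1 = uval z.2].
have mD : measurable D.
  have m1 : measurable_fun setT (fun z : I2 => uval z.1).
    exact: measurableT_comp measurable_uval measurable_fst.
  have m2 : measurable_fun setT (fun z : I2 => uval z.2).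
    exact: measurableT_comp measurable_uval measurable_snd.
  have := measurable_fun_eqr m1 m2 measurableT (Y := [set true]) I.
  by rewrite setTI (_ : _ @^-1` _ = D)//; apply/seteqP; split=> z /eqP.
exists (f @^-1` D); split.
- by rewrite -[X in measurable X]setTI; exact: mf.
- pose Q := measure_function_pushforward__canonical__measure_function_Measure P mf.
  have QE := @product_measure_unique _ _ _ _ _ (lebesgueI R) (lebesgueI R) Q
    (fun A B mA mB => coord_law2 mP ij mA mB) D mD.
  apply: (etrans (esym QE)); rewrite /product_measure1; apply: integral0_eq => u _ /=.
  rewrite -[RHS](lebesgueI_set1 (uval u)); congr (lebesgueI R _).
  apply/seteqP; split => v; first by rewrite /xsection /= inE.
  by rewrite /xsection /= inE.
- by move=> x /= /not_implyP[_ /negP]; rewrite negbK => /eqP.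
Qed.

Lemma ae_frequency : {ae P, forall x : Iinf R, forall q : rat, 0 < (ratr q : R) < 1 ->
  (count_le x (ratr q) (2 ^ k))%:R / (2 ^ k)%:R @[k --> \oo] --> (ratr q : R)}.
Proof.
have H (q : rat) : {ae P, forall x : Iinf R, 0 < (ratr q : R) < 1 ->
    (count_le x (ratr q) (2 ^ k))%:R / (2 ^ k)%:R @[k --> \oo] --> (ratr q : R)}.
  have [q01|] := boolP (0 < (ratr q : R) < 1); last by move=> _; exact: aeW.
  apply: filterS (frequency_cvg mP (measurable_uval_le (ratr q))) => x; move=> xq _.
  rewrite [X in _ --> X](_ : ratr q = fine (lebesgueI R [set u | uval u <= ratr q])).
    apply: cvg_trans xq.
    apply: near_eq_cvg; apply: nearW => k; congr (_ / _).
    rewrite /count_le natr_sum; apply: eq_bigr => i _; rewrite indicE.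
    by congr (nat_of_bool _)%:R; apply/idP/idP; rewrite inE.
  by rewrite lebesgueI_le.
(* An enumeration of the rationals turns the quantifier over [q] into one over [nat], which
   [ae_foralln] handles. *)
have {}H : {ae P, forall x : Iinf R, forall n q, unpickle n = Some q ->
    0 < (ratr q : R) < 1 ->
    (count_le x (ratr q) (2 ^ k))%:R / (2 ^ k)%:R @[k --> \oo] --> (ratr q : R)}.
  apply: ae_foralln => n; case: (unpickle n) => [q|]; last exact: aeW.
  by apply: filterS (H q) => x xq _ [<-].
by apply: filterS H => x xH q; apply: (xH (pickle q)); rewrite pickleK.
Qed.

(** Rationals [p] and [q] within [e] of [x k] squeeze its rank between the counts at [p] and at [q],
    whose normalized limits are [p] and [q]. *)
Lemma reconstruct_J (x : Iinf R) : injective x ->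
  (forall k, 0 < uval (x k) < 1) ->
  (forall q : rat, 0 < (ratr q : R) < 1 ->
   (count_le x (ratr q) (2 ^ k))%:R / (2 ^ k)%:R @[k --> \oo] --> (ratr q : R)) ->
  reconstruct (J x) = x.
Proof.
move=> x_inj x01 xfreq; apply: functional_extensionality_dep => k.
apply: reconstruct_eq; apply/cvgrPdist_lt => e e0.
set a : R := uval (x k); have /andP[a0 a1] : 0 < a < 1 := x01 k.
(* The maximum with 0, and then the minimum with 1, keep the two rationals in the open interval
   where [xfreq] applies. *)
have /rat_in_itvoo[p] : Num.max 0 (a - e) < a by rewrite gt_max a0 ltrBlDr ltrDl.
have /rat_in_itvoo[q] : a < Num.min 1 (a + e) by rewrite lt_min a1 ltrDl.
rewrite !in_itv /= lt_min gt_max => /and3P[aq q1 qe] /andP[/andP[p0 pe] pa].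
have cvp : (count_le x (ratr p) (2 ^ k))%:R / (2 ^ k)%:R @[k --> \oo] --> (ratr p : R).
  by apply: xfreq; rewrite p0 (lt_trans pa).
have cvq : (count_le x (ratr q) (2 ^ k))%:R / (2 ^ k)%:R @[k --> \oo] --> (ratr q : R).
  by apply: xfreq; rewrite q1 (lt_trans a0).
near=> j.
(* Only for [k < 2 ^ j] is [rank_in] a genuine rank rather than its junk value 0. *)
have kj : (k < 2 ^ j)%N.
  apply: leq_trans (ltn_expl j (isT : 1 < 2)%N); rewrite ltnS.
  by near: j; exact: nbhs_infty_ge.
have le_div (m n : nat) : (m <= n)%N -> m%:R / (2 ^ j)%:R <= n%:R / (2 ^ j)%:R :> R.
  by move=> mn; rewrite ler_wpM2r ?invr_ge0// ler_nat.
rewrite /rank_frequency rank_in_J// -/a ltr_distlC; apply/andP; split.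
  apply: lt_le_trans (le_div _ _ (leq_count_le x (2 ^ j) (ltW pa))).
  by near: j; exact: (cvgr_gt _ cvp).
apply: le_lt_trans (le_div _ _ (leq_count_le x (2 ^ j) (ltW aq))) _.
by near: j; exact: (cvgr_lt _ cvq).
Unshelve. all: by end_near. Qed.

Lemma ae_reconstruct_J : {ae P, forall x, reconstruct (J x) = x}.
Proof.
apply: filterS3 ae_distinct_coords ae_coords_in01 ae_frequency => x.
exact: reconstruct_J.
Qed.

End almost_sure_coordinates.

(** * The law of the ranks *)

Lemma ae_le_measure (R : realType) d (X : measurableType d)
    (P : {measure set X -> \bar R}) (A B : set X) :
  measurable A -> measurable B -> {ae P, forall x, A x -> B x} -> (P A <= P B)%E.
Proof.
move=> mA mB [N [mN N0 AN]]; rewrite -[leRHS]adde0 -N0.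
apply: le_trans (measureU2 _ mB mN); apply: le_measure; rewrite ?inE//.
  exact: measurableU.
move=> x Ax; have [Bx|nBx] := pselect (B x); first by left.
by right; apply: AN => /= /(_ Ax).
Qed.

Lemma ae_eq_measure (R : realType) d (X : measurableType d)
    (P : {measure set X -> \bar R}) (A B : set X) :
  measurable A -> measurable B -> {ae P, forall x, A x <-> B x} -> P A = P B.
Proof.
move=> mA mB AB; apply/eqP; rewrite eq_le; apply/andP; split.
  by apply: ae_le_measure => //; apply: filterS AB => x [].
by apply: ae_le_measure => //; apply: filterS AB => x [].
Qed.

Lemma measure_finType_bigcup (R : realType) d (X : measurableType d)
    (P : {measure set X -> \bar R}) (F : finType) (D : F -> set X) :
  (forall a, measurable (D a)) -> (forall a b x, D a x -> D b x -> a = b) ->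
  P (\bigcup_a D a) = (\sum_(a : F) P (D a))%E.
Proof.
move=> mD tD; rewrite (measure_fin_bigcup P)//; last 2 first.
- exact: finite_finset.
- by move=> a b _ _ [x [Dax Dbx]]; exact: tD Dax Dbx.
rewrite (_ : [set: F] = [set` enum F]).
  by rewrite -fsbig_seq ?enum_uniq// big_enum.
by apply/seteqP; split => a //= _; rewrite mem_enum.
Qed.

(** * Rearrangements of the first coordinates *)

Section order_cells.
Context {R : realType}.
Implicit Types x : Iinf R.

(** Fixing the indices from [n] on makes the permutation an injection of [nat], to which
    [precomp_preserving] applies. *)
Definition extend_perm n (s : 'S_n) (k : nat) : nat :=
  if insub k is Some i then val (s i) else k.

Lemma extend_perm_ord n (s : 'S_n) (i : 'I_n) : extend_perm s i = s i.
Proof. by rewrite /extend_perm valK. Qed.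

Lemma extend_perm_inj n (s : 'S_n) : injective (extend_perm s).
Proof.
move=> k l; rewrite /extend_perm.
case: insubP => [i _ <-|kn]; case: insubP => [j _ <-|ln].
- by move/val_inj/perm_inj ->.
- by move=> sl; rewrite -sl ltn_ord in ln.
- by move=> sk; rewrite sk ltn_ord in kn.
- by [].
Qed.

Definition rank_cell n (a : {ffun 'I_n -> 'I_n.+1}) : set (Iinf R) :=
  distinct_coords R `&` [set x | digits n (J x) = a].

Lemma measurable_rank_cell n (a : {ffun 'I_n -> 'I_n.+1}) : measurable (rank_cell a).
Proof.
apply: measurableI; first exact: measurable_distinct_coords.
exact: measurable_preimage measurable_J (measurable_digits a).
Qed.

(* If the permutations s and u both bring x into the same cell, then x o s and
   x o u are ordered alike, so that s i and u i occupy the same rank in x. *)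
Lemma rank_cell_perm_inj n (a : {ffun 'I_n -> 'I_n.+1}) x (s u : 'S_n) :
  rank_cell a (precomp (extend_perm s) x) ->
  rank_cell a (precomp (extend_perm u) x) -> s = u.
Proof.
move=> [s_inj sa] [u_inj ua].
have su := eq_J_order s_inj u_inj (digits_inj (etrans sa (esym ua))).
(* The count [r b] is unchanged by permuting the indices and strictly increases from each of the
   first [n] values to any larger number, so equal counts force equal values. *)
pose r (b : R) := (\sum_(l < n) (uval (x l) < b)%R)%N.
have r_perm (v : 'S_n) (b : R) : r b = (\sum_(l < n) (uval (x (v l)) < b)%R)%N.
  by rewrite /r (reindex_inj (@perm_inj _ v)).
have rE i : r (uval (x (s i))) = r (uval (x (u i))).
  rewrite (r_perm s) (r_perm u); apply: eq_bigr => l _; congr nat_of_bool.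
  have := su l i (ltn_ord l) (ltn_ord i).
  by rewrite /precomp !extend_perm_ord.
have r_lt i (b : R) : uval (x i) < b -> (i < n)%N -> (r (uval (x i)) < r b)%N.
  move=> ib i_n; rewrite /r (bigD1 (Ordinal i_n))//= [ltnRHS](bigD1 (Ordinal i_n))//=.
  rewrite ltxx ib add0n add1n ltnS; apply: leq_sum => l _.
  by case: ltP => // xl; rewrite (lt_trans xl ib).
apply/permP => i.
have xsu : uval (x (s i)) = uval (x (u i)).
  apply/eqP; rewrite eq_le !leNgt; apply/andP; split; apply/negP.
    by move/r_lt => /(_ (ltn_ord _)); rewrite rE ltnn.
  by move/r_lt => /(_ (ltn_ord _)); rewrite rE ltnn.
(* Injectivity is known for the rearranged sequence, so [x (u i)] is written as its term at
   [s^-1 (u i)]. *)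
have := s_inj i ((s^-1)%g (u i)); rewrite /precomp !extend_perm_ord permKV.
by move=> /(_ (uval_inj xsu))/val_inj iE; rewrite {1}iE permKV.
Qed.

End order_cells.

Section law_of_ranks.
Context {R : realType}.
Variables (P : probability (Iinf R) R) (mu : probability triangular R).
Hypothesis mP : is_product_measure (fun=> lebesgueI R) P.
Hypothesis muP : is_product_measure (uniform_digit R) mu.

Lemma rank_cell_le n (a : {ffun 'I_n -> 'I_n.+1}) : (P (rank_cell a) <= (n`!%:R^-1)%:E)%E.
Proof.
pose D (s : 'S_n) : set (Iinf R) := precomp (extend_perm s) @^-1` rank_cell a.
have mD s : measurable (D s).
  exact: measurable_preimage (measurable_precomp _) (measurable_rank_cell a).
have PD s : P (D s) = P (rank_cell a).
  have [_] := precomp_preserving mP (@extend_perm_inj n s); apply.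
  exact: measurable_rank_cell.
have PU : (P (\bigcup_s D s) <= 1)%E.
  apply: probability_le1; apply: fin_bigcup_measurable => // *.
  exact: finite_finset.
have := PU; rewrite measure_finType_bigcup//; last first.
  by move=> s u x; exact: rank_cell_perm_inj.
rewrite (eq_bigr (fun=> P (rank_cell a))); last by move=> s _; exact: PD.
have finP : P (rank_cell a) \is a fin_num.
  by apply: fin_num_measure; exact: measurable_rank_cell.
rewrite -(fineK finP) sumEFin !lee_fin sumr_const card_Sn -(mulr_natr (fine _)).
by rewrite -ler_pdivlMr ?ltr0n ?fact_gt0// div1r.
Qed.

Lemma uniform_digit1 k (s : digit k) : uniform_digit R k [set s] = (k.+1%:R^-1)%:E.
Proof.
rewrite /uniform_digit /mscale /= /counting asboolT; last exact: finite_set1.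
by rewrite fset_set1 finmap.cardfs1 mule1.
Qed.

Lemma digits_cell_law n (t : triangular) :
  mu [set t' | digits n t' = digits n t] = (n`!%:R^-1)%:E.
Proof.
have -> : [set t' | digits n t' = digits n t] = box n (fun k => [set t k]).
  apply/seteqP; split=> [t' tt' k kn|t' tt'].
    exact: (digits_inj tt' kn).
  by apply/ffunP => i; rewrite !ffunE (tt' i (ltn_ord i)).
apply: (etrans (muP n (fun=> I : measurable [set t _]))).
elim: n => [|n IH]; first by rewrite big_ord0 invr1.
by rewrite big_ord_recr /= IH uniform_digit1 -EFinM factS natrM invfM mulrC.
Qed.

Lemma law_of_ranks_le n (D : set triangular) : determined_by n D ->
  (P (@J R @^-1` D) <= mu D)%E.
Proof.
move=> nD; have DE : D = \bigcup_(a in digits n @` D) [set t | digits n t = a].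
  apply/seteqP; split=> [t Dt|t [_ [t' Dt' <-] /= tt']].
    by exists (digits n t) => //; exists t.
  by rewrite (nD _ _ (digits_inj tt')).
pose P' := measure_function_pushforward__canonical__measure_function_Measure P
  (@measurable_J R).
rewrite -[leLHS]/(P' D) DE.
have trivD : trivIset (digits n @` D) (fun a => [set t | digits n t = a]).
  by move=> a b _ _ [t /= [-> ->]].
have finD : finite_set (digits n @` D) by exact: finite_finset.
have mcell a : (digits n @` D) a -> measurable [set t | digits n t = a].
  by move=> _; exact: measurable_digits.
rewrite (measure_fin_bigcup P')// (measure_fin_bigcup mu)//.
apply: lee_fsum => // _ [t Dt <-].
apply: (@le_trans _ _ (n`!%:R^-1)%:E); last first.
  by rewrite le_eqVlt; apply/orP; left; apply/eqP/esym; exact: digits_cell_law.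
apply: le_trans (rank_cell_le (digits n t)).
have mJ := measurable_preimage (@measurable_J R) (measurable_digits (digits n t)).
(* The preimage of the cylinder and [rank_cell] differ only by sequences with repeated coordinates,
   a null set. *)
apply: (@ae_le_measure _ _ _ P _ _ mJ (measurable_rank_cell _)).
by apply: filterS (ae_distinct_coords mP) => x x_inj xt.
Qed.

Lemma law_of_ranks_determined n (D : set triangular) : determined_by n D ->
  P (@J R @^-1` D) = mu D.
Proof.
move=> nD; apply/eqP; rewrite eq_le (law_of_ranks_le nD) /=.
have mD := measurable_determined nD.
have mJD := measurable_preimage (@measurable_J R) mD.
(* The same bound for the complement is the reverse inequality for [D], as both measures have total
   mass 1. *)
have nDC : determined_by n (~` D).
  by move=> t t' tt'; rewrite /setC /mkset (nD _ _ tt').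
have := law_of_ranks_le nDC; rewrite preimage_setC.
rewrite (probability_setC P mJD) (probability_setC mu mD).
have fP : P (@J R @^-1` D) \is a fin_num by exact: fin_num_measure.
have fmu : mu D \is a fin_num by exact: fin_num_measure.
by rewrite -(fineK fP) -(fineK fmu) -!EFinB !lee_fin lerD2l lerN2.
Qed.

Lemma law_of_ranks D : measurable D -> P (@J R @^-1` D) = mu D.
Proof.
apply: (@countprod_pushforward_unique _ _ _ _ _ P mu); first exact: measurable_J.
move=> n A mA; apply: (@law_of_ranks_determined n) => t t' tt'.
apply/propext; split=> tA k kn; first by rewrite -tt'//; exact: tA.
by rewrite tt'//; exact: tA.
Qed.

End law_of_ranks.

(** * The isomorphism *)

Section isomorphism.
Context {R : realType}.
Variables (P : probability (Iinf R) R) (mu : probability triangular R).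
Hypothesis mP : is_product_measure (fun=> lebesgueI R) P.
Hypothesis muP : is_product_measure (uniform_digit R) mu.

Lemma ae_probability1 d (X : measurableType d) (Q : probability X R) (A : set X) :
  measurable A -> {ae Q, forall x, A x} <-> Q A = 1%E.
Proof.
move=> mA; split=> [aeA|QA].
  rewrite -[RHS](probability_setT Q); apply: ae_eq_measure => //.
  by apply: filterS aeA => x.
exists (~` A); split => //; first exact: measurableC.
by rewrite (probability_setC Q mA) QA subee.
Qed.

(** The set of full measure on which [reconstruct] inverts [J]; the strict bounds are those that
    Weyl cells demand. *)
Definition recoverable : set (Iinf R) := [set x | [/\ injective x,
  forall k, 0 < uval (x k) < 1 & reconstruct (J x) = x]].

(** All shifts are required to be recoverable so that the set is invariant under
    [bernoulli_shift]. *)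
Definition regular : set (Iinf R) :=
  [set x | forall m, recoverable (precomp (addn^~ m) x)].

(** This is the image of [regular] under [J], written through [reconstruct] so that it is visibly
    measurable. *)
Definition ranks_regular : set triangular :=
  [set t | regular (reconstruct t) /\ J (reconstruct t : Iinf R) = t].

Lemma measurable_recoverable : measurable recoverable.
Proof.
have -> : recoverable = distinct_coords R `&` \bigcap_k
    ([set x : Iinf R | 0 < uval (x k) < 1] `&`
     [set x | uval (reconstruct (J x) k) == uval (x k)]).
  apply/seteqP; split=> [x [x_inj x01 xE]|x [x_inj xE]].
    by split => // k _; split; [exact: x01|rewrite /= xE].
  split => // [k|]; first by case: (xE k I).
  apply: functional_extensionality_dep => k; apply: uval_inj.
  by case: (xE k I) => _ /eqP.
apply: measurableI; first exact: measurable_distinct_coords.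
apply: bigcap_measurableType => k _.
have mk := @measurable_ucoord R k.
apply: measurableI.
  rewrite (_ : mkset _ = (fun x : Iinf R => uval (x k)) @^-1` [set` `]0, 1[]).
    by apply: measurable_preimage => //; exact: measurable_itv.
  by apply/seteqP; split => x; rewrite /= in_itv.
have mr : measurable_fun setT (fun x : Iinf R => uval (reconstruct (R := R) (J x) k)).
  exact: (measurableT_comp mk (measurableT_comp measurable_reconstruct measurable_J)).
exact: (measurable_preimage (D := [set true]) (measurable_fun_eqr mr mk)).
Qed.

Lemma measurable_regular : measurable regular.
Proof.
have -> : regular = \bigcap_m precomp (addn^~ m) @^-1` recoverable.
  by apply/seteqP; split=> [x xr m _|x xr m]; exact: xr.
apply: bigcap_measurableType => m _.
exact: measurable_preimage (measurable_precomp _) measurable_recoverable.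
Qed.

Lemma ae_recoverable : {ae P, forall x, recoverable x}.
Proof.
by apply: filterS3 (ae_distinct_coords mP) (ae_coords_in01 mP)
  (ae_reconstruct_J mP) => x; split.
Qed.

(** Each shift preserves [P], so [regular] is a countable intersection of sets of full measure. *)
Lemma ae_regular : {ae P, forall x, regular x}.
Proof.
apply: ae_foralln => m.
have mS := measurable_preimage (measurable_precomp (addn^~ m)) measurable_recoverable.
apply/(ae_probability1 P mS).
have [_ ->] := precomp_preserving mP (@addIn m); last exact: measurable_recoverable.
exact/(ae_probability1 P measurable_recoverable)/ae_recoverable.
Qed.

Lemma regular_recoverable x : regular x -> recoverable x.
Proof.
move=> /(_ 0%N); rewrite (_ : precomp _ x = x)//.
by apply: functional_extensionality_dep => k; rewrite /precomp addn0.
Qed.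

Lemma regular_shift x : regular x -> regular (bernoulli_shift x).
Proof.
move=> xr m; have := xr m.+1; congr recoverable.
by apply: functional_extensionality_dep => k; rewrite /precomp addnS.
Qed.

Lemma eq_nmarked t t' n : (forall i, (i < n)%N -> t i = t' i) ->
  nmarked t n = nmarked t' n.
Proof.
elim: n => // n IH tt'; rewrite /= IH ?tt'// => i i_n.
by rewrite tt'// ltnW.
Qed.

Lemma measurable_Lambda : measurable_fun setT Lambda.
Proof.
apply: measurable_countprod => k; apply: (@measurable_fun_determined _ _ k.+2).
move=> t t' tt'; apply: val_inj; rewrite /= /Lambda_val /marked tt'//.
by rewrite (@eq_nmarked t t')// => i ik; rewrite tt'// ltnW.
Qed.

(** [mu] is the law of [J] and [J] intertwines the maps almost everywhere, so invariance passes from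
    the Bernoulli shift to [Lambda]. *)
Lemma Lambda_preserving : measure_preserving mu Lambda.
Proof.
split=> [|D mD]; first exact: measurable_Lambda.
have mLD := measurable_preimage measurable_Lambda mD.
have mJD := measurable_preimage (@measurable_J R) mD.
have mJLD := measurable_preimage (@measurable_J R) mLD.
have [mS SP] := precomp_preserving mP succn_inj.
rewrite -(law_of_ranks mP muP mLD) -(law_of_ranks mP muP mD) -(SP _ mJD).
have mSJD := measurable_preimage mS mJD.
apply: (@ae_eq_measure _ _ _ P _ _ mJLD mSJD).
apply: filterS (ae_distinct_coords mP) => x x_inj.
by rewrite /preimage /= -(J_shift x_inj).
Qed.

Lemma measurable_ranks_regular : measurable ranks_regular.
Proof.
have mr := @measurable_reconstruct R.
rewrite (_ : ranks_regular = reconstruct (R := R) @^-1` regular `&`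
  [set t | J (reconstruct (R := R) t) = t])//.
apply: measurableI; first exact: measurable_preimage mr measurable_regular.
have -> : [set t : triangular | J (reconstruct (R := R) t) = t] =
    \bigcap_k [set t | J (reconstruct (R := R) t) k = t k].
  apply/seteqP; split=> [t /= tE k _ /=|t tE]; first by rewrite tE.
  by apply: functional_extensionality_dep => k; exact: tE.
apply: bigcap_measurableType => k _.
pose f (b : bool) (t : triangular) : 'I_k.+2 :=
  inord (digit_val (if b then J (reconstruct (R := R) t) k else t k)).
have digit_inord (s s' : digit k) :
    inord (digit_val s) = inord (digit_val s') :> 'I_k.+2 -> s = s'.
  move=> /(congr1 (@nat_of_ord _)).
  have /andP[_ sk] := valP s; have /andP[_ s'k] := valP s'.
  by rewrite !inordK// => /val_inj.
apply: (@measurable_finfun_fibers _ _ bool 'I_k.+2 f) => [b a|t t' tt' /= tE].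
  have mk := @measurable_coord _ digit k.
  apply: (@measurable_preimage _ _ _ (digit k) _ [set s | inord (digit_val s) = a]) => //.
  by case: b; [exact: measurableT_comp mk (measurableT_comp measurable_J mr)|].
apply: digit_inord; have := tt' true; have := tt' false; rewrite /f /= => <- <-.
by rewrite tE.
Qed.

Lemma regular_J x : regular x -> ranks_regular (J x).
Proof. by move=> xr; have [_ _ xE] := regular_recoverable xr; split; rewrite xE. Qed.

Lemma J_is_metric_isomorphism :
  is_metric_isomorphism P (@bernoulli_shift R) mu Lambda (@J R).
Proof.
split; [exact (precomp_preserving mP succn_inj)|exact: Lambda_preserving|].
have mA := measurable_regular; have mB := measurable_ranks_regular.
exists regular, ranks_regular; split.
- by split => //; apply/(ae_probability1 P mA); exact: ae_regular.
- split => //; rewrite -(law_of_ranks mP muP mB).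
  apply/(ae_probability1 P (measurable_preimage (@measurable_J R) mB)).
  by apply: filterS ae_regular => x; exact: regular_J.
- split=> [x|t [tr tE]]; first exact: regular_shift.
  have [t_inj _ _] := regular_recoverable tr.
  (* Since [t] is [J] of its reconstruction, [Lambda t] is [J] of the shifted reconstruction. *)
  have := regular_J (regular_shift tr).
  by rewrite (J_shift t_inj) tE.
- split=> [x|x y|t [tr tE]].
  + exact: regular_J.
  + rewrite !inE => /regular_recoverable[_ _ xE] /regular_recoverable[_ _ yE] Jxy.
    by rewrite -xE Jxy yE.
  + by exists (reconstruct t).
- split=> [D mD DB|C mC CA|x /regular_recoverable[x_inj _ _]].
  + have mJD := measurable_preimage (@measurable_J R) mD.
    have mAJD := measurableI _ _ mA mJD.
    split => //; rewrite -(law_of_ranks mP muP mD).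
    apply: ae_eq_measure => //; apply: filterS ae_regular => x xr.
    by split=> [[]|].
  (* [reconstruct] inverts [J] on [ranks_regular], so the image of [C] becomes a preimage under a
     measurable map. *)
  + have -> : @J R @` C = ranks_regular `&` reconstruct (R := R) @^-1` C.
      apply/seteqP; split=> [_ [x Cx <-]|t [[tr tE] Ct]]; last by exists (reconstruct t).
      have xr := CA _ Cx; split; first exact: regular_J.
      by rewrite /preimage /=; have [_ _ ->] := regular_recoverable xr.
    by apply: measurableI => //; exact: measurable_preimage measurable_reconstruct mC.
  + exact: J_shift.
Qed.

End isomorphism.

(** * Weyl partitions *)

Section weyl_partitions.
Context {R : realType}.
Implicit Types (x y : Iinf R) (C : set (Iinf R)).

Definition order_pattern n x : rel 'I_n := fun i j => uval (x i) < uval (x j).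

Definition order_cell n x : set (Iinf R) :=
  cylinder (weyl_cell (@order_pattern n x)).

(** A point of a cell reveals the relation defining it; disjointness of the cells follows as
    well. *)
Lemma weyl_partitionP n C x : weyl_partition R n C -> C x ->
  C = order_cell n x.
Proof.
move=> [W [_ [r ->]] <-] [_ _ xr]; rewrite /order_cell; congr (cylinder (weyl_cell _)).
apply: functional_extensionality_dep => i; apply: functional_extensionality_dep => j.
by rewrite /order_pattern xr.
Qed.

Lemma weyl_partition_cell n x : injective x -> (forall k, 0 < uval (x k) < 1) ->
  weyl_partition R n (order_cell n x) /\
  order_cell n x x.
Proof.
move=> x_inj x01.
have xW : weyl_cell (@order_pattern n x) (fun i : 'I_n => x i).
  by split=> // i j /x_inj/val_inj.
split=> //; exists (weyl_cell (@order_pattern n x)) => //; split.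
  by exists (fun i : 'I_n => x i).
by exists (@order_pattern n x).
Qed.

Lemma finite_weyl_partition n : finite_set (weyl_partition R n).
Proof.
pose cell (f : {ffun 'I_n * 'I_n -> bool}) : set (Iinf R) :=
  cylinder (weyl_cell (fun i j => f (i, j))).
apply: (@sub_finite_set _ _ (cell @` setT)); last first.
  by apply: finite_image; exact: finite_finset.
move=> _ [W [_ [r ->]] <-]; exists [ffun ij => r ij.1 ij.2] => //.
congr (cylinder (weyl_cell _)).
apply: functional_extensionality_dep => i; apply: functional_extensionality_dep => j.
by rewrite ffunE.
Qed.

Lemma measurable_weyl_cylinder n (r : rel 'I_n) :
  measurable (cylinder (weyl_cell r) : set (Iinf R)).
Proof.
pose b (k : 'I_n * 'I_n + 'I_n) x : bool :=
  match k with
  | inl ij => uval (x ij.1) < uval (x ij.2)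
  | inr i => 0 < uval (x i) < 1
  end.
apply: (@measurable_bits _ _ _ b).
  move=> [ij|i]; first exact: measurable_lt_coord.
  rewrite (_ : mkset _ = (fun x : Iinf R => uval (x i)) @^-1` [set` `]0, 1[]).
    by apply: measurable_preimage; [exact: measurable_ucoord|exact: measurable_itv].
  by apply/seteqP; split => x; rewrite /= in_itv.
move=> x y xy [x01 x_inj xr].
have lt_xy (i j : 'I_n) : (uval (x i) < uval (x j)) = (uval (y i) < uval (y j)).
  exact: (xy (inl (i, j))).
split=> [i|i j yij|i j]; first by have := xy (inr i) => /= <-.
  (* Coordinates are equal when neither strict inequality holds, so injectivity too is read off the
     bits [b]. *)
  apply/x_inj/uval_inj/eqP; rewrite eq_le !leNgt !lt_xy yij.
  by rewrite ltxx.
by rewrite -lt_xy xr.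
Qed.

Lemma weyl_partition_nonempty n C : weyl_partition R n C -> C !=set0.
Proof.
move=> [W [[y Wy] _] <-].
exists (fun k => if insub k is Some i then y i else point).
rewrite /cylinder /= (_ : (fun i : 'I_n => _) = y)//.
by apply: functional_extensionality_dep => i; rewrite valK.
Qed.

Lemma measurable_weyl_partition n C : weyl_partition R n C -> measurable C.
Proof. by move=> [W [_ [r ->]] <-]; exact: measurable_weyl_cylinder. Qed.

(** The coarser cell is obtained by restricting the order pattern to the first [m] coordinates. *)
Lemma weyl_partition_refines m n : (m <= n)%N ->
  refines (weyl_partition R n) (weyl_partition R m).
Proof.
move=> mn C Cn; have [x Cx] := weyl_partition_nonempty Cn.
have CE := weyl_partitionP Cn Cx; rewrite {}CE in Cn Cx *.
have sub : order_cell n x `<=`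
    order_cell m x.
  move=> y [y01 y_inj yr]; split=> [i|i j yij|i j].
  - exact: (y01 (widen_ord mn i)).
  - by apply/val_inj; have /(congr1 val) := y_inj (widen_ord mn i) (widen_ord mn j) yij.
  - exact: (yr (widen_ord mn i) (widen_ord mn j)).
exists (order_cell m x) => //.
exists (weyl_cell (@order_pattern m x)) => //; split; last by exists (@order_pattern m x).
by exists (fun i : 'I_m => x i); exact: sub Cx.
Qed.

(** Each rank counts comparisons [x i <= x k], the negations of [x k < x i], which the order
    patterns record. *)
Lemma eq_order_pattern_J x y :
  (forall n, @order_pattern n x = @order_pattern n y) -> J x = J y.
Proof.
move=> xy; apply: functional_extensionality_dep => k; apply: val_inj.
rewrite /= !J_valE; apply: eq_bigr => i _; congr nat_of_bool.
rewrite !leNgt; congr (~~ _).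
by have := congr1 (fun r : rel 'I_k.+1 => r ord_max i) (xy k.+1).
Qed.

Section mod0.
Variable P : probability (Iinf R) R.
Hypothesis mP : is_product_measure (fun=> lebesgueI R) P.

Lemma weyl_partition_mod0 n : finite_partition_mod0 P (weyl_partition R n).
Proof.
split=> [|C Cn|C D Cn Dn [x [Cx Dx]]|].
- exact: finite_weyl_partition.
- by split; [exact: measurable_weyl_partition Cn|exact: weyl_partition_nonempty Cn].
- by rewrite (weyl_partitionP Cn Cx) (weyl_partitionP Dn Dx).
- have mU : measurable (\bigcup_(C in weyl_partition R n) C).
    by apply: fin_bigcup_measurable; [exact: finite_weyl_partition|
      exact: measurable_weyl_partition].
  apply/(ae_probability1 P mU); apply: filterS (ae_recoverable mP) => x [x_inj x01 _].
  have [xn xx] := weyl_partition_cell n x_inj x01.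
  by exists (order_cell n x).
Qed.

(** Recoverable points lying in the same cell for every [n] have the same order patterns, hence the
    same ranks, hence coincide by [reconstruct]. *)
Lemma weyl_partitions_exhaust :
  eq_partition_mod0 P (partition_product (weyl_partition R)) point_partition.
Proof.
have mA := @measurable_recoverable R.
exists recoverable; split => //.
  exact/(ae_probability1 P mA)/ae_recoverable.
apply/seteqP; split=> [_ [[C [C0 [F Fn CF]] <-] CA0]|_ [[_ [x _ <-] <-] xA0]].
- split=> //; have /set0P[x [Cx Ax]] : C `&` recoverable != set0 by exact/eqP.
  exists [set x]; first by exists x.
  apply/seteqP; split=> [_ [-> _]//|y [Cy Ay]]; split => //=.
  have [_ _ <-] := Ax; have [_ _ <-] := Ay; congr reconstruct.
  apply: eq_order_pattern_J => n.
  have Fx : F n x by move: Cx; rewrite CF => /(_ n I).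
  have Fy : F n y by move: Cy; rewrite CF => /(_ n I).
  have := Fx; rewrite (weyl_partitionP (Fn n) Fy) => -[_ _ xy].
  apply: functional_extensionality_dep => i.
  by apply: functional_extensionality_dep => j; rewrite -xy.
- split=> //; have /set0P[_ [-> [x_inj x01 xE]]] : [set x] `&` recoverable != set0.
    exact/eqP.
  have Fx n := weyl_partition_cell n x_inj x01.
  exists (\bigcap_n order_cell n x).
    split; first by exists x => n _; case: (Fx n).
    by exists (order_cell ^~ x) => // n; case: (Fx n).
  apply/seteqP; split=> [y [Fy Ay]|_ [-> Ax]]; last first.
    by split=> // n _; case: (Fx n).
  split=> //=; have [_ _ <-] := Ay; rewrite -xE; congr reconstruct.
  apply: eq_order_pattern_J => n; have [_ _ yx] := Fy n I.
  apply: functional_extensionality_dep => i.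
  by apply: functional_extensionality_dep => j; rewrite -yx.
Qed.

End mod0.
End weyl_partitions.

Theorem theorem4 (R : realType)
    (minf : probability (Iinf R) R) (mu : probability triangular R)
    (minfP : is_product_measure (fun=> lebesgueI R) minf)
    (muP : is_product_measure (uniform_digit R) mu) :
  [/\ metrically_isomorphic minf (@bernoulli_shift R) mu Lambda,
      [/\ {ae minf, forall x, distinct_coords R x},
          is_metric_isomorphism minf (@bernoulli_shift R) mu Lambda (@J R)
        & {ae minf, forall x, J (bernoulli_shift x) = Lambda (J x)}]
    & [/\ forall n, finite_partition_mod0 minf (weyl_partition R n),
          forall m n, (m <= n)%N -> refines (weyl_partition R n) (weyl_partition R m)
        & eq_partition_mod0 minf (partition_product (weyl_partition R)) point_partition]].
Proof.
have isoJ := J_is_metric_isomorphism minfP muP.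
have distinct := ae_distinct_coords minfP.
split; first by exists (@J R).
  by split=> //; apply: filterS distinct => x; exact: J_shift.
split; first exact: weyl_partition_mod0.
  by move=> m n; exact: weyl_partition_refines.
exact: weyl_partitions_exhaust.
Qed.
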